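(* Let $\delta\ge0$ be a constant, $f:\mathbb{R}^m\to\mathbb{R}$ be $C^{1,1}$, and $\boldsymbol{U}\in\mathbb{R}^{n\times m}$ be such that $\boldsymbol{U}^{\mathrm{T}}\boldsymbol{U}=\boldsymbol{I}$. Suppose that $g:\mathbb{R}^n\to\mathbb{R}$ satisfies $g(\boldsymbol{x})=f(\boldsymbol{U}^{\mathrm{T}}\boldsymbol{x})$ for all $\boldsymbol{x}\in\mathbb{R}^n$. Then $$\partial_{\delta}^2g(\boldsymbol{x})(\boldsymbol{w})=\boldsymbol{U}\,\partial_{\delta}^2f(\boldsymbol{U}^{\mathrm{T}}\boldsymbol{x})(\boldsymbol{U}^{\mathrm{T}}\boldsymbol{w})\quad\text{for all }\boldsymbol{x},\boldsymbol{w}\in\mathbb{R}^n.$$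
   Context: A function $f:\mathbb{R}^d\to\mathbb{R}$ is $C^{1,1}$ if it is differentiable with Lipschitz continuous gradient. $\mathbb{B}^d$ is the closed Euclidean unit ball of $\mathbb{R}^d$ and $\operatorname{conv}$ is the convex hull. For a set $S\subseteq\mathbb{R}^m$, $\boldsymbol{U}S:=\{\boldsymbol{U}\boldsymbol{z}:\boldsymbol{z}\in S\}$. For a $C^{1,1}$-function $f:\mathbb{R}^d\to\mathbb{R}$, the Clarke generalized Hessian $\partial_{\mathrm{C}}^2f(\boldsymbol{x})\subseteq\mathbb{R}^{d\times d}_{\mathrm{sym}}$ is the convex hull of the set of all limits $\lim_j\nabla^2f(\boldsymbol{y}_j)$ along sequences $\boldsymbol{y}_j\to\boldsymbol{x}$ of points at which $f$ is twice differentiable, and $\partial_{\mathrm{C}}^2f(\boldsymbol{x})(\boldsymbol{w}):=\{\boldsymbol{A}\boldsymbol{w}:\boldsymbol{A}\in\partial_{\mathrm{C}}^2f(\boldsymbol{x})\}$. The Goldstein second-order $\delta$-subdifferential is the set-valued mapping $\partial_{\delta}^2f(\boldsymbol{x})(\boldsymbol{w}):=\operatorname{conv}\big(\bigcup_{\boldsymbol{y}\in\boldsymbol{x}+\delta\mathbb{B}^d}\partial_{\mathrm{C}}^2f(\boldsymbol{y})(\boldsymbol{w})\big)$, $\boldsymbol{w}\in\mathbb{R}^d$. *)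

(* Defs.v *)
From HB Require Import structures.
From mathcomp Require Export all_boot all_order all_algebra.
From mathcomp Require Export all_classical all_reals all_analysis.

Set Implicit Arguments.
Unset Strict Implicit.
Unset Printing Implicit Defensive.

Import Order.TTheory GRing.Theory Num.Theory.
Import numFieldNormedType.Exports.

Local Open Scope classical_set_scope.
Local Open Scope ring_scope.

(* The library norm on ['cV[R]_d] is the sup norm.  It induces the usual
   topology and notion of differentiability, but not the Euclidean ball. *)
Definition enorm (R : realType) (d : nat) (x : 'cV[R]_d) : R :=
  Num.sqrt (\sum_(i < d) x i 0 ^+ 2).

Definition eunit_ball (R : realType) (d : nat) : set 'cV[R]_d :=
  [set x | enorm x <= 1].
Arguments eunit_ball : clear implicits.

Definition gradient (R : realType) (d : nat) (f : 'cV[R]_d -> R)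
    (x : 'cV[R]_d) : 'cV[R]_d :=
  \col_(i < d) 'D_(delta_mx i 0) f x.

Definition C11 (R : realType) (d : nat) (f : 'cV[R]_d -> R) : Prop :=
  (forall x : 'cV[R]_d, differentiable f x) /\
  (exists L : R, forall x y : 'cV[R]_d,
     enorm (gradient f x - gradient f y) <= L * enorm (x - y)).

Definition twice_differentiable (R : realType) (d : nat)
    (f : 'cV[R]_d -> R) (x : 'cV[R]_d) : Prop :=
  (\forall y \near x, differentiable f y) /\ differentiable (gradient f) x.

(* Entry (i, j) is the j-th partial derivative of the i-th component of the
   gradient.  Both this and [gradient] are junk where the derivatives involved
   do not exist. *)
Definition hessian (R : realType) (d : nat) (f : 'cV[R]_d -> R)
    (x : 'cV[R]_d) : 'M[R]_d :=
  \matrix_(i < d, j < d) ('D_(delta_mx j 0) (gradient f) x) i 0.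

Definition convex_hull (R : realType) (V : lmodType R) (A : set V) : set V :=
  smallest (@convex_set R V) A.

Definition clarke_hessian (R : realType) (d : nat) (f : 'cV[R]_d -> R)
    (x : 'cV[R]_d) : set 'M[R]_d :=
  convex_hull [set A : 'M[R]_d | exists y : nat -> 'cV[R]_d,
    [/\ forall j, twice_differentiable f (y j),
        y j @[j --> \oo] --> x &
        hessian f (y j) @[j --> \oo] --> A]].

Definition clarke_hessian_at (R : realType) (d : nat) (f : 'cV[R]_d -> R)
    (x w : 'cV[R]_d) : set 'cV[R]_d :=
  [set A *m w | A in clarke_hessian f x].

Definition goldstein_subdiff2 (R : realType) (d : nat) (delta : R)
    (f : 'cV[R]_d -> R) (x w : 'cV[R]_d) : set 'cV[R]_d :=
  convex_hull
    (\bigcup_(y in [set x + delta *: b | b in eunit_ball R d])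
       clarke_hessian_at f y w).

(* Main.v *)
Require Import Defs.
Import Order.TTheory GRing.Theory Num.Theory.
Import numFieldNormedType.Exports.
Local Open Scope classical_set_scope.
Local Open Scope ring_scope.

(** The columns of [U] are orthonormal, so [U^T] is a left inverse of [U].
    Hence [g] is [f] precomposed with the linear map [U^T], and conversely
    [f z = g (c + U z)] for any [c] with [U^T c = 0].  The chain rule along an
    affine map transports twice differentiability both ways, so [g] is twice
    differentiable at [y] exactly when [f] is at [U^T y], and there
    [hessian g y = U (hessian f (U^T y)) U^T].

    Limits of Hessians then correspond under [H |-> U H U^T]
    ([limiting_hessians_isometry]): a sequence [y_j -> x] projects to
    [U^T y_j -> U^T x], and a sequence [z_j -> U^T x] lifts to
    [x + U (z_j - U^T x) -> x], whose projection is [z_j] again.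

    The rest is linear algebra.  Convex hulls commute with linear maps
    ([convex_hull_image]); this is used once for [H |-> U H U^T], inside the
    Clarke Hessian, and once for [z |-> U z], around the union over the ball.
    The two unions match because [U] maps the unit ball of R^m into that of
    R^n, while [U^T] maps the unit ball of R^n into that of R^m. *)

Set Implicit Arguments.
Unset Strict Implicit.

(** * Convex hulls and linear maps *)

Lemma linear_conv (R : realType) (V W : lmodType R) (L : {linear V -> W})
    (t : {i01 R}) (x y : convex_lmodType V) :
  L (conv t x y) = conv t (L x : convex_lmodType W) (L y).
Proof. by rewrite [LHS]linearD !linearZ. Qed.

(** Images and preimages of convex sets under [L] are convex: the image of the
    hull of [A] is a convex set containing [L A], and the preimage of any
    convex set containing [L A] is a convex set containing [A]. *)
Lemma convex_hull_image (R : realType) (V W : lmodType R)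
    (L : {linear V -> W}) (A : set V) :
  convex_hull [set L v | v in A] = [set L v | v in convex_hull A].
Proof.
apply/seteqP; split.
  apply: smallest_sub => [x y t|_ [v Av <-]]; last first.
    by exists v => //; exact: sub_gen_smallest.
  rewrite !inE => -[v hv <-] [u hu <-].
  exists (conv t (v : convex_lmodType V) (u : convex_lmodType V)).
    move=> C CA; have [cC _] := CA.
    by apply: set_mem; apply: cC; apply/mem_set; [apply: hv|apply: hu].
  exact: linear_conv.
move=> _ [v hv <-] C [cC AC]; apply: (hv (L @^-1` C)); split => [x y t|u Au].
  move=> /set_mem xC /set_mem yC; apply/mem_set.
  by have /set_mem := cC _ _ t (mem_set xC) (mem_set yC); rewrite -linear_conv.
by apply: AC; exists u.
Qed.

(** * Gradients and Hessians along affine maps *)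

Lemma linear_mx_continuous (R : realType) (p q : nat) (V : normedModType R)
    (L : {linear 'M[R]_(p, q) -> V}) : continuous L.
Proof.
have -> : (L : _ -> V) =
    (fun A : 'M[R]_(p, q) => \sum_i \sum_j A i j *: L (delta_mx i j)).
  apply/funext => A; rewrite {1}(matrix_sum_delta A) linear_sum.
  apply: eq_bigr => i _; rewrite linear_sum.
  by apply: eq_bigr => j _; rewrite linearZ.
apply: continuous_big => [|i _]; first exact: add_continuous.
apply: continuous_big => [|j _]; first exact: add_continuous.
move=> A; have cA := @coord_continuous R p q i j A.
exact: (@cvgZr_tmp R V _ (nbhs A) _ _ _ (L (delta_mx i j)) cA).
Qed.

Lemma linear_mx_cvg (R : realType) (p q : nat) (V : normedModType R)
    (L : {linear 'M[R]_(p, q) -> V}) (u : nat -> 'M[R]_(p, q))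
    (a : 'M[R]_(p, q)) :
  u j @[j --> \oo] --> a -> L (u j) @[j --> \oo] --> L a.
Proof.
by move=> ua; apply: continuous_cvg => //; exact: linear_mx_continuous.
Qed.

Lemma gradientE (R : realType) (d : nat) (f : 'cV[R]_d -> R)
    (v x : 'cV[R]_d) :
  differentiable f x -> 'D_v f x = \sum_i v i 0 * gradient f x i 0.
Proof.
move=> df; rewrite deriveE// {1}(matrix_sum_delta v) linear_sum.
by apply: eq_bigr => i _; rewrite big_ord1 linearZ /= mxE deriveE.
Qed.

Lemma hessianE (R : realType) (d : nat) (f : 'cV[R]_d -> R)
    (v x : 'cV[R]_d) :
  differentiable (gradient f) x -> 'D_v (gradient f) x = hessian f x *m v.
Proof.
move=> df; apply/colP => i.
rewrite deriveE// {1}(matrix_sum_delta v) linear_sum summxE mxE.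
by apply: eq_bigr => j _; rewrite big_ord1 linearZ /= !mxE deriveE// mulrC.
Qed.

Section ChainRule.
Variables (R : realType) (p q : nat) (A : 'M[R]_(q, p)) (c : 'cV[R]_q).

Lemma differentiable_affine (x : 'cV[R]_p) :
  differentiable (fun y : 'cV[R]_p => c + A *m y) x.
Proof.
apply: differentiableD; first exact: differentiable_cst.
exact/linear_differentiable/linear_mx_continuous.
Qed.

(** The difference quotients of both sides coincide. *)
Lemma derive_affine (V : normedModType R) (F : 'cV[R]_q -> V)
    (v x : 'cV[R]_p) :
  'D_v (fun y => F (c + A *m y)) x = 'D_(A *m v) F (c + A *m x).
Proof.
rewrite /derive; apply: (congr1 (fun G : R -> V => lim (G @ 0^'))).
by apply/funext => h /=; rewrite mulmxDr -scalemxAr addrCA.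
Qed.

Lemma gradient_affine (f : 'cV[R]_q -> R) (x : 'cV[R]_p) :
  differentiable f (c + A *m x) ->
  gradient (fun y => f (c + A *m y)) x = A^T *m gradient f (c + A *m x).
Proof.
move=> df; apply/colP => i; rewrite mxE derive_affine gradientE// mxE.
by apply: eq_bigr => k _; rewrite -colE !mxE.
Qed.

Variable f : 'cV[R]_q -> R.
Hypothesis df : forall x, differentiable f x.

Let h y := f (c + A *m y).

Lemma differentiable_comp_affine x : differentiable h x.
Proof.
by apply: (@differentiable_comp _ _ _ _ (fun y => c + A *m y) f);
  [exact: differentiable_affine|exact: df].
Qed.

Let grad_h : gradient h = mulmx A^T \o (fun y => gradient f (c + A *m y)).
Proof. by apply/funext => y /=; rewrite /h gradient_affine. Qed.

Let dgrad x : twice_differentiable f (c + A *m x) ->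
  differentiable (fun y => gradient f (c + A *m y)) x.
Proof.
move=> [_ df2].
by apply: (@differentiable_comp _ _ _ _ (fun y => c + A *m y) (gradient f));
  [exact: differentiable_affine|exact: df2].
Qed.

Lemma twice_differentiable_affine x :
  twice_differentiable f (c + A *m x) -> twice_differentiable h x.
Proof.
move=> df2; split; first by near=> y; exact: differentiable_comp_affine.
rewrite grad_h; apply: differentiable_comp; first exact: dgrad.
exact/linear_differentiable/linear_mx_continuous.
Unshelve. all: by end_near. Qed.

(** Both Hessians represent the differential of a gradient, and
    [gradient h = A^T (gradient f) (c + A _)], so both sides agree as linear
    maps, hence column by column. *)
Lemma hessian_affine x :
  twice_differentiable f (c + A *m x) ->
  hessian h x = A^T *m hessian f (c + A *m x) *m A.
Proof.
move=> df2; have [_ d2h] := twice_differentiable_affine df2.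
have [_ d2f] := df2.
have E (v : 'cV[R]_p) :
    hessian h x *m v = A^T *m hessian f (c + A *m x) *m A *m v.
  have cA : continuous (mulmx A^T : 'cV[R]_q -> 'cV[R]_p).
    exact: linear_mx_continuous.
  rewrite -hessianE// deriveE// grad_h diff_comp; last 2 first.
  - exact: dgrad.
  - exact: linear_differentiable.
  rewrite diff_lin//= -deriveE; last exact: dgrad.
  by rewrite derive_affine hessianE// !mulmxA.
by apply/matrixP => i j; have /colP/(_ i) := E (delta_mx j 0);
  rewrite -!colE !mxE.
Qed.

End ChainRule.

(** * Unit balls under a matrix with orthonormal columns *)

Lemma enorm_le1 (R : realType) d (x : 'cV[R]_d) :
  (enorm x <= 1) = ((x^T *m x) 0 0 <= 1).
Proof.
rewrite /enorm -[X in _ <= X]sqrtr1 ler_sqrt// mxE.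
by under [in RHS]eq_bigr do rewrite mxE -expr2.
Qed.

Section Isometry.
Variables (R : realType) (m n : nat) (U : 'M[R]_(n, m)).
Hypothesis UTU : U^T *m U = 1%:M.

Lemma eunit_ball_isometry (b : 'cV[R]_m) :
  eunit_ball R m b -> eunit_ball R n (U *m b).
Proof.
by rewrite /eunit_ball /= !enorm_le1 trmx_mul mulmxA -(mulmxA b^T) UTU mulmx1.
Qed.

(** Pythagoras: [U U^T] is an orthogonal projection, so
    [|b|^2 - |U^T b|^2 = |b - U U^T b|^2]. *)
Lemma eunit_ball_coisometry (b : 'cV[R]_n) :
  eunit_ball R n b -> eunit_ball R m (U^T *m b).
Proof.
rewrite /eunit_ball /= !enorm_le1; apply: le_trans.
pose r := b - U *m (U^T *m b).
have rE : r^T *m r = b^T *m b - (U^T *m b)^T *m (U^T *m b).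
  rewrite /r [X in X *m _ = _]linearB /= !trmx_mul trmxK mulmxBl !mulmxBr.
  rewrite !mulmxA.
  by rewrite -(mulmxA (b^T *m U) U^T U) UTU mulmx1 subrr subr0.
rewrite -subr_ge0; have -> : (b^T *m b) 0 0 - ((U^T *m b)^T *m (U^T *m b)) 0 0
  = (r^T *m r) 0 0 by rewrite rE [RHS]mxE [X in _ = _ + X]mxE.
by rewrite mxE; apply: sumr_ge0 => i _; rewrite mxE -expr2 sqr_ge0.
Qed.

(** * Second-order subdifferentials of f o U^T *)

(** [clarke_hessian f x] is the convex hull of this set. *)
Definition limiting_hessians (d : nat) (f : 'cV[R]_d -> R)
    (x : 'cV[R]_d) : set 'M[R]_d :=
  [set A : 'M[R]_d | exists y : nat -> 'cV[R]_d,
    [/\ forall j, twice_differentiable f (y j),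
        y j @[j --> \oo] --> x &
        hessian f (y j) @[j --> \oo] --> A]].

(** [H |-> B H B^T], written as a composite so as to inherit linearity. *)
Definition mx_congruence (p q : nat) (B : 'M[R]_(p, q))
  : {linear 'M[R]_q -> 'M[R]_p} := mulmxr B^T \o mulmx B.

Variables (f : 'cV[R]_m -> R) (g : 'cV[R]_n -> R).
Hypothesis df : forall x, differentiable f x.
Hypothesis gE : forall x, g x = f (U^T *m x).

Let gEc : g = (fun y => f (0 + U^T *m y)).
Proof. by apply/funext => y; rewrite add0r. Qed.

Let dg x : differentiable g x.
Proof. by rewrite gEc; exact: differentiable_comp_affine. Qed.

(** The offset [y - U U^T y] lies in the kernel of [U^T]; it is chosen so that
    the affine map sends [U^T y] to [y], which need not be in the range
    of [U]. *)
Let fE y : f = (fun z => g (y - U *m (U^T *m y) + U *m z)).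
Proof.
apply/funext => z; rewrite gE mulmxDr mulmxBr !mulmxA UTU !mul1mx.
by rewrite subrr add0r.
Qed.

Lemma twice_differentiable_isometry y :
  twice_differentiable g y <-> twice_differentiable f (U^T *m y).
Proof.
split => d2.
  rewrite (fE y); apply: twice_differentiable_affine; first exact: dg.
  by rewrite subrK.
by rewrite gEc; apply: twice_differentiable_affine; rewrite ?add0r.
Qed.

Lemma hessian_isometry y : twice_differentiable f (U^T *m y) ->
  hessian g y = mx_congruence U (hessian f (U^T *m y)).
Proof. by move=> d2; rewrite gEc hessian_affine ?add0r// trmxK. Qed.

(** From left to right, a limit [K] of Hessians of [g] is only known to be
    [U H U^T] because each Hessian in the sequence is: [H := U^T K U] is the
    limit of the Hessians of [f], and [U H U^T = K] by uniqueness of limits. *)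
Lemma limiting_hessians_isometry x :
  limiting_hessians g x =
  [set mx_congruence U H | H in limiting_hessians f (U^T *m x)].
Proof.
apply/seteqP; split => [K [y [d2y yx hK]]|_ [H [z [d2z zx hH]] <-]].
  have d2f j : twice_differentiable f (U^T *m y j).
    exact/twice_differentiable_isometry.
  have hg j : hessian g (y j) = mx_congruence U (hessian f (U^T *m y j)).
    exact: hessian_isometry.
  have hf j : hessian f (U^T *m y j) = mx_congruence U^T (hessian g (y j)).
    by rewrite hg /= trmxK !mulmxA UTU mul1mx -mulmxA UTU mulmx1.
  have hfK : hessian f (U^T *m y j) @[j --> \oo] --> mx_congruence U^T K.
    under eq_fun do rewrite hf.
    exact: (linear_mx_cvg (L := mx_congruence U^T) hK).
  exists (mx_congruence U^T K).
    exists (fun j => U^T *m y j); split=> //.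
    exact: (linear_mx_cvg (L := mulmx U^T) yx).
  have hgK : hessian g (y j) @[j --> \oo] -->
      mx_congruence U (mx_congruence U^T K).
    under eq_fun do rewrite hg.
    exact: (linear_mx_cvg (L := mx_congruence U) hfK).
  exact: (cvg_unique _ hgK hK).
pose y j := x + U *m (z j - U^T *m x).
have Uy j : U^T *m y j = z j.
  by rewrite mulmxDr !mulmxA UTU mul1mx addrC subrK.
exists y; split.
- by move=> j; apply/twice_differentiable_isometry; rewrite Uy.
- rewrite -[X in _ --> X]addr0 -(mulmx0 _ U) -(subrr (U^T *m x)).
  apply: cvgD; first exact: cvg_cst.
  apply: (linear_mx_cvg (L := mulmx U)).
  by apply: cvgB => //; exact: cvg_cst.
- under eq_fun do rewrite hessian_isometry ?Uy//.
  exact: (linear_mx_cvg (L := mx_congruence U) hH).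
Qed.

Lemma clarke_hessian_at_isometry x w :
  clarke_hessian_at g x w =
  [set U *m z | z in clarke_hessian_at f (U^T *m x) (U^T *m w)].
Proof.
rewrite /clarke_hessian_at /clarke_hessian.
rewrite -/(limiting_hessians g x) -/(limiting_hessians f (U^T *m x)).
rewrite limiting_hessians_isometry convex_hull_image !image_comp.
by congr image; apply/funext => H /=; rewrite !mulmxA.
Qed.

(** A point of the ball around [x] is projected by [U^T]; a point
    [U^T x + delta b] is lifted to [x + delta U b], which projects back to it.
    By [clarke_hessian_at_isometry], [clarke_hessian_at g y w] depends on [y]
    only through [U^T y]. *)
Lemma bigcup_ball_isometry (delta : R) x w :
  \bigcup_(y in [set x + delta *: b | b in eunit_ball R n])
    clarke_hessian_at g y w =
  [set U *m z | z in
    \bigcup_(y in [set U^T *m x + delta *: b | b in eunit_ball R m])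
      clarke_hessian_at f y (U^T *m w)].
Proof.
rewrite image_bigcup; apply/seteqP; split => v [_ [b bB <-]].
  rewrite clarke_hessian_at_isometry => hv.
  exists (U^T *m (x + delta *: b)) => //; exists (U^T *m b).
    exact: eunit_ball_coisometry.
  by rewrite mulmxDr -scalemxAr.
move=> hv; exists (x + delta *: (U *m b)).
  by exists (U *m b) => //; exact: eunit_ball_isometry.
rewrite clarke_hessian_at_isometry.
by rewrite mulmxDr -scalemxAr (mulmxA _ U) UTU mul1mx.
Qed.

End Isometry.

Theorem corollary2p9 (R : realType) (m n : nat) (delta : R)
    (f : 'cV[R]_m -> R) (U : 'M[R]_(n, m)) (g : 'cV[R]_n -> R) :
  0 <= delta ->
  C11 f ->
  U^T *m U = 1%:M ->
  (forall x : 'cV[R]_n, g x = f (U^T *m x)) ->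
  forall x w : 'cV[R]_n,
    goldstein_subdiff2 delta g x w =
    [set U *m z | z in goldstein_subdiff2 delta f (U^T *m x) (U^T *m w)].
Proof.
move=> _ [df _] UTU gE x w.
rewrite /goldstein_subdiff2 (bigcup_ball_isometry UTU df gE).
exact: (convex_hull_image (mulmx U)).
Qed.
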